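(* Let $K\subset\mathbb{R}^n$ be a nonempty closed set and let $f:\mathbb{R}^n\to\mathbb{R}$ be a polynomial of degree $d\geq 2$. If the problem $\mathrm{OP}(K,f)$ is regular and $f$ is bounded from below on $K$, then the solution set $\mathrm{Sol}(K,f)$ is nonempty and compact.
   Context: $\mathrm{OP}(K,f)$ denotes the problem of minimizing $f(x)$ subject to $x\in K$, and $\mathrm{Sol}(K,f)$ denotes its set of (global) minimizers; $\mathrm{Sol}(S,g)$ has the same meaning for any closed set $S$ and polynomial $g$. The asymptotic cone of a nonempty closed set $S\subset\mathbb{R}^n$ is $S_\infty=\{v\in\mathbb{R}^n:\exists t_k\to+\infty,\ \exists x_k\in S \text{ with } \lim_{k\to\infty} x_k/t_k=v\}$. $f_d$ denotes the homogeneous component of degree $d$ of $f$, where $d=\deg f$. The problem $\mathrm{OP}(K,f)$ is called regular if $\mathrm{Sol}(K_\infty,f_d)$ is bounded (the empty set counts as bounded), and non-regular otherwise. *)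

(* Defs.v *)
From HB Require Import structures.
From mathcomp Require Import all_boot all_order all_algebra.
(* The notations of [mpoly] clash with those of mathcomp-analysis. *)
From mathcomp Require Import -(notations) mpoly.
From mathcomp Require Import all_classical all_reals all_analysis.

Set Implicit Arguments.
Unset Strict Implicit.
Unset Printing Implicit Defensive.

Import Order.TTheory GRing.Theory Num.Theory numFieldNormedType.Exports.
Local Open Scope classical_set_scope.
Local Open Scope ring_scope.

Definition peval (R : realType) (n : nat) (p : mpoly.mpoly n R) (x : 'rV[R]_n) : R :=
  mpoly.meval (fun i => x ord0 i) p.

(* [msize] is the total degree plus one, and 0 for the zero polynomial. *)
Definition pdegree (R : realType) (n : nat) (p : mpoly.mpoly n R) : nat :=
  (mpoly.msize p).-1.

Definition leading_form (R : realType) (n : nat) (p : mpoly.mpoly n R) :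
    mpoly.mpoly n R :=
  mpoly.pihomog (@mdeg n) (pdegree p) p.

Definition Sol (R : realType) (n : nat) (S : set 'rV[R]_n)
    (g : mpoly.mpoly n R) : set 'rV[R]_n :=
  [set x | S x /\ forall y, S y -> peval g x <= peval g y].

Definition asymptotic_cone (R : realType) (n : nat) (S : set 'rV[R]_n) :
    set 'rV[R]_n :=
  [set v : 'rV[R]_n | exists t : nat -> R, exists x : nat -> 'rV[R]_n,
    [/\ t k @[k --> \oo] --> +oo,
        forall k, S (x k) &
        (t k)^-1 *: x k @[k --> \oo] --> v]].

Definition regular (R : realType) (n : nat) (K : set 'rV[R]_n)
    (f : mpoly.mpoly n R) : Prop :=
  bounded_set (Sol (asymptotic_cone K) (leading_form f)).

(* Main.v *)
Require Import Defs.
From mathcomp Require Import all_boot all_order all_algebra.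
From mathcomp Require Import -(notations) mpoly.
From mathcomp Require Import all_classical all_reals all_analysis.
Set Implicit Arguments.
Unset Strict Implicit.
Unset Printing Implicit Defensive.

Import Order.TTheory GRing.Theory Num.Theory numFieldNormedType.Exports.
Local Open Scope classical_set_scope.
Local Open Scope ring_scope.

(** The proof is the direct method: it suffices that the sublevel sets
    [K `&` [set x | peval f x <= c]] are compact ([sublevel_compact]). Then [f]
    attains its minimum on a nonempty one of them, which is the minimum on [K],
    and the solution set is itself a sublevel set.

    Sublevel sets are closed, so only boundedness is at stake, and there
    regularity enters ([sublevel_bounded]). An unbounded sublevel set contains
    points [x k] with [`|x k|] tending to infinity whose directions converge to
    a unit vector [v] of the asymptotic cone of [K]
    ([unbounded_asymptotic_direction]). Along any sequence with [t k --> +oo]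
    and [x k / t k --> v], the quotients [f (x k) / t k ^ d] converge to the
    value at [v] of the leading form ([cvg_leading_form]), while a constant
    divided by [t k ^ d] tends to 0. So a lower bound for [f] on [K] makes the
    leading form nonnegative on the cone, and the upper bound [c] on the
    sublevel set makes it nonpositive at [v]. Hence 0 is the minimum of the
    leading form on the cone, attained at [v] and, by homogeneity, on the whole
    ray through [v]: its solution set is unbounded, contradicting regularity.

    All facts about [f] that involve a limit come from one object, the
    homogenization [F (s, y)] of [f]. It is jointly continuous, satisfies
    [F (a s, a y) = a ^ d F (s, y)], and interpolates between [f] (at [s = 1])
    and its leading form (at [s = 0]), so that
    [f x / t ^ d = F (1 / t, x / t)]. *)

Definition homogenization (R : realType) (n : nat) (f : mpoly.mpoly n R)
    (s : R) (y : 'rV[R]_n) : R :=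
  \sum_(m <- msupp f)
    mcoeff m f * (s ^+ (pdegree f - mdeg m)
                  * \prod_i y ord0 i ^+ fun_of_multinom m i).

Section Homogenization.
Context {R : realType} {n : nat}.
Implicit Types (f : mpoly.mpoly n R) (x y v : 'rV[R]_n).

Lemma mdeg_le_pdegree f m : m \in msupp f -> (mdeg m <= pdegree f)%N.
Proof. by move=> /msize_mdeg_lt; rewrite /pdegree; case: (msize f). Qed.

Lemma homogenization1 f y : homogenization f 1 y = peval f y.
Proof.
by rewrite /peval mevalE; apply: eq_bigr => m _; rewrite expr1n mul1r.
Qed.

(** At [s = 0] only the monomials with exponent [pdegree f - mdeg m = 0]
    survive, because [0 ^+ 0 = 1]. *)
Lemma homogenization0 f y : homogenization f 0 y = peval (leading_form f) y.
Proof.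
rewrite /peval /leading_form pihomogE raddf_sum /= /homogenization.
rewrite [RHS]big_mkcond /= !big_seq; apply: eq_bigr => m mf.
rewrite expr0n subn_eq0; have := mdeg_le_pdegree mf.
rewrite leq_eqVlt => /orP[/eqP ->|md].
  by rewrite leqnn eqxx mul1r mevalZ mevalX.
by rewrite leqNgt md (ltn_eqF md) mul0r mulr0.
Qed.

Lemma homogenizationZ f a s y :
  homogenization f (a * s) (a *: y) = a ^+ pdegree f * homogenization f s y.
Proof.
rewrite /homogenization mulr_sumr !big_seq; apply: eq_bigr => m mf.
rewrite -[X in a ^+ X](subnK (mdeg_le_pdegree mf)) exprD exprMn.
under eq_bigr do rewrite mxE exprMn.
rewrite big_split /= prodrXr -mdegE.
by rewrite [RHS]mulrCA mulrACA.
Qed.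

(** Convergence along an arbitrary filter serves both the limit at infinity
    ([s --> 0]) and the continuity of [f] ([s] constantly 1). *)
Lemma cvg_homogenization {T : Type} {F : set_system T} {FF : Filter F}
    f (s : T -> R) (y : T -> 'rV[R]_n) (a : R) v :
  s k @[k --> F] --> a -> y k @[k --> F] --> v ->
  homogenization f (s k) (y k) @[k --> F] --> homogenization f a v.
Proof.
move=> sa yv; rewrite /homogenization.
apply: cvg_big => [|m _]; first exact: add_continuous.
apply: cvgM; first exact: cvg_cst.
apply: cvgM; first exact: (cvg_comp _ _ sa (@exprn_continuous _ _ _)).
apply: cvg_big => [|i _]; first exact: mul_continuous.
have yi : y k ord0 i @[k --> F] --> v ord0 i.
  exact: (cvg_comp _ _ yv (@coord_continuous _ _ _ _ _ _)).
exact: (cvg_comp _ _ yi (@exprn_continuous _ _ _)).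
Qed.

Lemma continuous_peval f : continuous (peval f).
Proof.
have -> : peval f = homogenization f 1.
  by apply/funext => y; rewrite homogenization1.
move=> x; apply: (@cvg_homogenization _ _ (nbhs_filter x) f (fun=> 1) id).
  exact: cst_continuous.
exact: cvg_id.
Qed.

Lemma leading_formZ f a y :
  peval (leading_form f) (a *: y) = a ^+ pdegree f * peval (leading_form f) y.
Proof. by rewrite -!homogenization0 -homogenizationZ mulr0. Qed.

(** By homogeneity the left-hand side is the homogenization at
    [((t k)^-1, (t k)^-1 *: x k)], a point that converges to [(0, v)]. *)
Lemma cvg_leading_form f (t : nat -> R) (x : nat -> 'rV[R]_n) v :
  t k @[k --> \oo] --> +oo -> (t k)^-1 *: x k @[k --> \oo] --> v ->
  (t k)^-1 ^+ pdegree f * peval f (x k) @[k --> \oo]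
    --> peval (leading_form f) v.
Proof.
move=> ty xv; rewrite -homogenization0.
under eq_fun do rewrite -homogenization1 -homogenizationZ mulr1.
apply: cvg_homogenization => //.
by apply/gtr0_cvgV0 => //; exact: cvgry_gt.
Qed.

End Homogenization.

Section AsymptoticCone.
Context {R : realType} {n : nat}.
Implicit Types (S K : set 'rV[R]_n) (f : mpoly.mpoly n R) (v : 'rV[R]_n).

Lemma asymptotic_cone_sub S K :
  S `<=` K -> asymptotic_cone S `<=` asymptotic_cone K.
Proof.
by move=> SK v [t [x [ty Sx xv]]]; exists t, x; split => // k; exact: SK.
Qed.

Lemma asymptotic_coneZ S (a : R) v :
  0 < a -> asymptotic_cone S v -> asymptotic_cone S (a *: v).
Proof.
move=> a0 [t [x [ty Sx xv]]]; exists (fun k => t k * a^-1), x; split => //.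
  apply/cvgryPge => A; near=> k; rewrite ler_pdivlMr//.
  by near: k; exact: cvgry_ge.
under eq_fun do rewrite invfM invrK mulrC -scalerA.
by apply: cvgZ => //; exact: cvg_cst.
Unshelve. all: by end_near. Qed.

(** Points of [S] whose norms exceed any bound, once normalized, lie on the
    compact unit sphere, and a cluster point of these directions belongs to the
    asymptotic cone, with the norms themselves as scaling factors. *)
Lemma unbounded_asymptotic_direction S :
  ~ bounded_set S -> exists2 v, asymptotic_cone S v & `|v| = 1.
Proof.
move=> Sunb.
have Sfar (k : nat) : exists x, S x /\ k%:R < `|x|.
  apply: contrapT => nfar; apply: Sunb; exists k%:R; split => [|M kM x Sx].
    exact: num_real.
  rewrite /= leNgt; apply/negP => Mx; apply: nfar; exists x; split => //.
  exact: lt_trans Mx.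
have [x /all_and2[Sx xfar]] := choice Sfar.
have x_gt0 k : 0 < `|x k| by apply: le_lt_trans (xfar k).
pose u k := `|x k|^-1 *: x k.
pose sphere := [set y : 'rV[R]_n | `|y| = 1].
have u_sphere k : sphere (u k).
  by rewrite /sphere /= normrZ gtr0_norm ?invr_gt0// mulVf ?gt_eqF.
have sphere_compact : compact sphere.
  apply: bounded_closed_compact.
    by exists 1; split => [|M M1 y /= ->]; [exact: num_real|exact: ltW].
  have -> : sphere = (fun y => `|y|) @^-1` [set 1] by [].
  by apply: closed_comp => [y _|]; [exact: norm_continuous|exact: closed_eq].
have [|v [v1 uv]] := sphere_compact (u @ \oo) _.
  by exists 0%N => // k _; exact: u_sphere.
(* The indices [j k] play the role of a subsequence converging to [v]; they
   need not increase, since [k <= j k] already sends the norms to infinity. *)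
have near_v (k : nat) : exists j, (k <= j)%N /\ ball v k.+1%:R^-1 (u j).
  have [||_ [[j /= kj <-] vj]] :=
      uv (u @` [set j | (k <= j)%N]) (ball v k.+1%:R^-1).
  - by exists k => // j /= kj; exists j.
  - by apply: nbhsx_ballx; rewrite invr_gt0.
  by exists j.
have [j /all_and2[jk jv]] := choice near_v.
exists v => //; exists (fun k => `|x (j k)|), (x \o j); split => //=.
- apply/cvgryPge => A; near=> k.
  apply: le_trans (ltW (xfar _)).
  apply: (@le_trans _ _ k%:R); last by rewrite ler_nat.
  by near: k; exact: nbhs_infty_ger.
- apply/cvg_ballP => e e0; near=> k.
  apply: le_ball (jv k).
  by apply: ltW; near: k; exact: near_infty_natSinv_lt (PosNum e0).
Unshelve. all: by end_near. Qed.

Lemma cvg_inv_expr0 (t : nat -> R) (d : nat) (c : R) :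
  (0 < d)%N -> t k @[k --> \oo] --> +oo ->
  (t k)^-1 ^+ d * c @[k --> \oo] --> (0 : R).
Proof.
move=> d0 ty; rewrite -(mul0r c); apply: cvgM; last exact: cvg_cst.
have t0 : (t k)^-1 @[k --> \oo] --> (0 : R).
  by apply/gtr0_cvgV0 => //; exact: cvgry_gt.
have := cvg_comp _ _ t0 (@exprn_continuous _ d _).
by rewrite expr0n gtn_eqF.
Qed.

(** Dividing the bound [c] by [t k ^ d] makes it vanish in the limit, so
    only its existence matters. *)
Lemma leading_form_ge0 S f (c : R) v : (0 < pdegree f)%N ->
  (forall x, S x -> c <= peval f x) ->
  asymptotic_cone S v -> 0 <= peval (leading_form f) v.
Proof.
move=> d0 fc [t [x [ty Sx xv]]].
apply: (ler_cvg_to (cvg_inv_expr0 c d0 ty) (cvg_leading_form ty xv)).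
near=> k; apply: ler_wpM2l; last exact: fc.
by apply: exprn_ge0; rewrite invr_ge0; near: k; exact: cvgry_ge.
Unshelve. all: by end_near. Qed.

Lemma leading_form_le0 S f (c : R) v : (0 < pdegree f)%N ->
  (forall x, S x -> peval f x <= c) ->
  asymptotic_cone S v -> peval (leading_form f) v <= 0.
Proof.
move=> d0 fc [t [x [ty Sx xv]]].
apply: (ler_cvg_to (cvg_leading_form ty xv) (cvg_inv_expr0 c d0 ty)).
near=> k; apply: ler_wpM2l; last exact: fc.
by apply: exprn_ge0; rewrite invr_ge0; near: k; exact: cvgry_ge.
Unshelve. all: by end_near. Qed.

End AsymptoticCone.

Section Sublevel.
Context {R : realType} {n : nat}.
Implicit Types (K : set 'rV[R]_n) (f : mpoly.mpoly n R).

(** The heart of the proof: an unbounded sublevel set has a unit asymptotic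
    direction [v], and the bounds on [f] from above (on the sublevel set) and
    below (on [K]) make the leading form vanish at [v] and nonnegative on the
    asymptotic cone. The minimizers of the leading form then contain the
    whole ray spanned by [v], against regularity. *)
Lemma sublevel_bounded K f (c : R) :
  (0 < pdegree f)%N -> regular K f ->
  has_lbound [set peval f x | x in K] ->
  bounded_set (K `&` [set x | peval f x <= c]).
Proof.
move=> f_deg f_regular [b fb].
apply: contrapT => /unbounded_asymptotic_direction[v Lv v1].
have lf_ge0 w : asymptotic_cone K w -> 0 <= peval (leading_form f) w.
  by apply: (leading_form_ge0 (c := b)) => // x Kx; apply: fb; exists x.
have Kv : asymptotic_cone K v := asymptotic_cone_sub (@subIsetl _ _ _) Lv.
have lfv0 : peval (leading_form f) v = 0.
  apply/le_anti; rewrite lf_ge0// andbT.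
  by apply: (leading_form_le0 (c := c)) Lv => // x [].
have [M [_ Mbound]] := f_regular.
(* Any length above [`|M| + 1] works: [Mbound] bounds the norms by [`|M| + 1],
   which exceeds [M]. *)
have a0 : 0 < `|M| + 2 by rewrite ltr_wpDl.
have Sol_ray : Sol (asymptotic_cone K) (leading_form f) ((`|M| + 2) *: v).
  split=> [|w Kw]; first exact: asymptotic_coneZ.
  by rewrite leading_formZ lfv0 mulr0 lf_ge0.
have /= := Mbound (`|M| + 1) _ _ Sol_ray.
rewrite normrZ v1 mulr1 gtr0_norm// lerD2l lern1 => /(_ _)/negP; apply => //.
by rewrite (le_lt_trans (ler_norm M))// ltrDl.
Qed.

Lemma sublevel_compact K f (c : R) :
  closed K -> (0 < pdegree f)%N -> regular K f ->
  has_lbound [set peval f x | x in K] ->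
  compact (K `&` [set x | peval f x <= c]).
Proof.
move=> K_closed f_deg f_regular f_bounded.
apply: bounded_closed_compact; first exact: sublevel_bounded.
apply: closedI => //.
have -> : [set x | peval f x <= c] = peval f @^-1` [set r | r <= c] by [].
by apply: closed_comp => [x _|]; [exact: continuous_peval|exact: closed_le].
Qed.

End Sublevel.

Theorem theorem3p1 (R : realType) (n : nat) (K : set 'rV[R]_n)
    (f : mpoly.mpoly n R) :
  K !=set0 -> closed K ->
  (2 <= pdegree f)%N ->
  regular K f ->
  has_lbound [set peval f x | x in K] ->
  Sol K f !=set0 /\ compact (Sol K f).
Proof.
move=> [x0 Kx0] K_closed f_deg2 f_reg f_bnd.
have f_deg : (0 < pdegree f)%N by exact: ltnW.
have Lcompact c : compact (K `&` [set x | peval f x <= c]).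
  exact: sublevel_compact.
have L_nonempty : K `&` [set x | peval f x <= peval f x0] !=set0.
  by exists x0; split=> /=.
have f_cont := continuous_subspaceT (@continuous_peval R n f).
have [z /set_mem[/= Kz _] zmin] :=
  compact_EVT_min L_nonempty (Lcompact _) (f_cont _).
(* Outside the sublevel set of [x0] the values of [f] exceed that at [x0]. *)
have Sz : Sol K f z.
  split=> // y Ky; have [yx0|/ltW x0y] := leP (peval f y) (peval f x0).
    by apply: zmin; apply/mem_set.
  by apply: le_trans x0y; apply: zmin; apply/mem_set; split => /=.
split; first by exists z.
(* The minimizers are themselves a sublevel set, at the minimal value. *)
suff -> : Sol K f = K `&` [set x | peval f x <= peval f z] by exact: Lcompact.
apply/seteqP; split=> x /= [Kx fx]; split=> //.
  exact: fx Kz.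
by move=> y Ky; apply: le_trans fx _; case: Sz => _; exact.
Qed.
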